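(* Let $\mathcal{G}$ be a connected bipartite graph with $s$ edges, the (even) cycles of which, $\mathcal{H}_1,\dots,\mathcal{H}_m$, with $\mathcal{H}_i\cong\mathcal{C}_{2k_i}$, have (pairwise) disjoint vertex sets. Let $X$ be the algebraic toric set associated to $\mathcal{G}$ over $K=\mathbb{F}_q$. Then $$\operatorname{reg} S/I(X)=(q-2)\Big(s-\sum_{i=1}^m k_i-1\Big).$$
   Context: $K=\mathbb{F}_q$ is a finite field with $q>2$ elements, $K^*=K\setminus\{0\}$, and $\mathbb{P}^{s-1}$ is the projective space of dimension $s-1$ over $K$. Graphs are simple, without isolated vertices and with at least two edges; $\mathcal{C}_{2k}$ denotes the cycle with $2k$ vertices. For a graph $\mathcal{G}$ with vertices $v_1,\dots,v_n$ and edges $e_1,\dots,e_s$, for $\mathbf{x}\in(K^* )^n$ and $e_i=\{v_j,v_l\}$ put $\mathbf{x}^{e_i}=x_jx_l$. The algebraic toric set associated to $\mathcal{G}$ is $X=\{[(\mathbf{x}^{e_1},\dots,\mathbf{x}^{e_s})]:\mathbf{x}\in(K^* )^n\}\subset\mathbb{P}^{s-1}$, and $I(X)\subset S=K[t_1,\dots,t_s]$ (standard grading) is the ideal generated by the homogeneous polynomials vanishing on $X$. The Hilbert function is $H_X(d)=\dim_K(S/I(X))_d$; the Hilbert polynomial $h_X$ of $S/I(X)$ is the constant $|X|$. The regularity $\operatorname{reg} S/I(X)$ is the least integer $\ell\ge0$ such that $H_X(d)=h_X(d)$ for all $d\ge\ell$. Here $\mathcal{H}_1,\dots,\mathcal{H}_m$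 are all the subgraphs of $\mathcal{G}$ that are cycles. *)

(* Defs.v *)
From mathcomp Require Import all_boot all_order all_algebra.
From mathcomp Require Import mpoly.
From Stdlib Require Import ClassicalEpsilon.

Set Implicit Arguments.
Unset Strict Implicit.
Unset Printing Implicit Defensive.

Import GRing.Theory.
Local Open Scope ring_scope.

Record graph (V : finType) := Graph {
  verts : {set V};
  edges : {set {set V}}
}.

Definition simple (V : finType) (G : graph V) : Prop :=
  forall a, a \in edges G -> a \subset verts G /\ #|a| = 2%N.

Definition subgraph (V : finType) (H G : graph V) : Prop :=
  [/\ simple H, verts H \subset verts G & edges H \subset edges G].

Definition adjacent (V : finType) (G : graph V) : rel V :=
  [rel x y | [set x; y] \in edges G].

Definition connected (V : finType) (G : graph V) : Prop :=
  verts G != set0 /\ {in verts G &, forall x y, connect (adjacent G) x y}.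

Definition bipartite (V : finType) (G : graph V) : Prop :=
  exists A : {set V}, forall x y, adjacent G x y -> (x \in A) != (y \in A).

Definition no_isolated (V : finType) (G : graph V) : Prop :=
  forall x, x \in verts G -> exists y, adjacent G x y.

Definition graph_iso (V W : finType) (G : graph V) (H : graph W) : Prop :=
  exists f : V -> W,
    [/\ {in verts G &, injective f}, f @: verts G = verts H
      & [set f @: (a : {set V}) | a in edges G] = edges H].

(* [ordS i] is the cyclic successor [i.+1 %% n]; this is the cycle with n
   vertices only for [3 <= n], whence the guard in [is_cycle]. *)
Definition cycle_graph (n : nat) : graph 'I_n :=
  Graph setT [set [set i; ordS i] | i : 'I_n].

Definition is_cycle (V : finType) (H : graph V) (n : nat) : Prop :=
  (3 <= n)%N /\ graph_iso (cycle_graph n) H.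

Definition graph_of (V : finType) (s : nat) (e : 'I_s -> {set V}) : graph V :=
  Graph setT [set e i | i : 'I_s].

(* A point of P^{s-1} is represented by the set of its homogeneous
   coordinate vectors. *)
Definition proj_point (K : finFieldType) (s : nat) (v : 'rV[K]_s) :
  {set 'rV[K]_s} := [set c *: v | c : K & c != 0].

Definition edge_monomials (K : finFieldType) (V : finType) (s : nat)
  (e : 'I_s -> {set V}) (x : {ffun V -> K}) : 'rV[K]_s :=
  \row_(i < s) \prod_(j in e i) x j.

Definition toric_set (K : finFieldType) (V : finType) (s : nat)
  (e : 'I_s -> {set V}) : {set {set 'rV[K]_s}} :=
  [set proj_point (edge_monomials e x)
     | x : {ffun V -> K} & [forall j, x j != 0]].

Definition vanishes_on (K : finFieldType) (s : nat)
  (X : {set {set 'rV[K]_s}}) (f : {mpoly K[s]}) : Prop :=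
  forall P v, P \in X -> v \in P -> f.@[v 0] = 0.

Definition ideal_gen (R : comNzRingType) (G : R -> Prop) (f : R) : Prop :=
  exists2 t : seq (R * R),
    forall ag, ag \in t -> G ag.2 & f = \sum_(ag <- t) ag.1 * ag.2.

Definition vanishing_ideal (K : finFieldType) (s : nat)
  (X : {set {set 'rV[K]_s}}) : {mpoly K[s]} -> Prop :=
  ideal_gen (fun g => g \is homog mdeg /\ vanishes_on X g).

Lemma linear_closed_vspace (K : fieldType) (T : vectType K) (P : T -> Prop) :
  P 0 -> (forall a u v, P u -> P v -> P (a *: u + v)) ->
  exists U : {vspace T}, forall u, u \in U <-> P u.
Proof.
move=> P0 PL.
suff H n : forall U : {vspace T}, (forall u, u \in U -> P u) ->
    (\dim {: T} - \dim U < n)%N ->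
    exists U' : {vspace T}, forall u, u \in U' <-> P u.
  by apply: (H _ 0%VS _ (ltnSn _)) => u; rewrite memv0 => /eqP->.
elim: n => // n IHn U UP Un.
have [Pu|nPu] := classic (forall u, P u -> u \in U).
  by exists U => u; split; [exact: UP | exact: Pu].
have [u uPU] := not_all_ex_not _ _ nPu.
have [Pu /negP uU] := imply_to_and _ _ uPU.
apply: (IHn (U + <[u]>)%VS).
  move=> _ /memv_addP[x xU [_ /vlineP[c ->] ->]].
  by rewrite addrC; apply: PL => //; apply: UP.
have UU : (U <= U + <[u]>)%VS by exact: addvSl.
have lt : (\dim U < \dim (U + <[u]>))%N.
  rewrite ltn_neqAle dimvS // andbT; apply: contra uU => /eqP dE.
  have/eqP-> : U == (U + <[u]>)%VS by rewrite eqEdim UU dE leqnn.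
  by rewrite memvE addvSr.
have le : (\dim (U + <[u]>) <= \dim {: T})%N by rewrite dimvS ?subvf.
move: Un; rewrite !ltnS => Un.
by apply: leq_trans Un; apply: ltn_sub2l => //; apply: leq_trans le.
Qed.

Lemma vanishing_ideal_component_ex (K : finFieldType) (r : nat)
    (X : {set {set 'rV[K]_r.+1}}) (d : nat) :
  exists U : {vspace dhomog r.+1 K d},
    forall p : dhomog r.+1 K d,
      p \in U <-> vanishing_ideal X (mpoly_of_dhomog p).
Proof.
apply: (@linear_closed_vspace _ _ (fun p : dhomog r.+1 K d =>
  vanishing_ideal X (mpoly_of_dhomog p))) => [|a u v [t tG ut] [t' tG' vt]].
  by exists [::]; rewrite ?big_nil.
exists ([seq (a *: ag.1, ag.2) | ag <- t] ++ t').
  move=> ag; rewrite mem_cat => /orP[/mapP[bg bgt ->]|]; last exact: tG'.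
  exact: (tG bg).
rewrite linearP /= ut vt big_cat big_map /= scaler_sumr; congr (_ + _).
by apply: eq_bigr => ag _; rewrite scalerAl.
Qed.

(* I(X)_d, a subspace of S_d = dhomog r.+1 K d.  The library makes S_d a
   vector space only for a successor number of variables. *)
Definition vanishing_ideal_component (K : finFieldType) (r : nat)
  (X : {set {set 'rV[K]_r.+1}}) (d : nat) : {vspace dhomog r.+1 K d} :=
  proj1_sig
    (constructive_indefinite_description _ (vanishing_ideal_component_ex X d)).

Lemma vanishing_ideal_componentP (K : finFieldType) (r : nat)
    (X : {set {set 'rV[K]_r.+1}}) (d : nat) (p : dhomog r.+1 K d) :
  p \in vanishing_ideal_component X d <->
  vanishing_ideal X (mpoly_of_dhomog p).
Proof.
rewrite /vanishing_ideal_component.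
by case: constructive_indefinite_description.
Qed.

(* (S/I(X))_d = S_d / I(X)_d. *)
Definition hilbert_function (K : finFieldType) (r : nat)
  (X : {set {set 'rV[K]_r.+1}}) (d : nat) : nat :=
  (\dim {: dhomog r.+1 K d} - \dim (vanishing_ideal_component X d))%N.

Definition is_hilbert_poly (H : nat -> nat) (h : {poly rat}) : Prop :=
  exists d0, forall d, (d0 <= d)%N -> (H d)%:R = h.[d%:R].

Definition is_regularity (K : finFieldType) (r : nat)
  (X : {set {set 'rV[K]_r.+1}}) (l : nat) : Prop :=
  exists2 h : {poly rat}, is_hilbert_poly (hilbert_function X) h &
    (forall d, (l <= d)%N -> (hilbert_function X d)%:R = h.[d%:R]) /\
    (forall l', (forall d, (l' <= d)%N ->
       (hilbert_function X d)%:R = h.[d%:R]) -> (l <= l')%N).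

(* Main.v *)
(* Put N = q - 1.  Monomials restrict to characters of the torus of points of
   K^V without zero coordinate, and distinct characters are linearly
   independent, so H_X(d) counts the vectors of residues mod N at the vertices
   of the form [boundary e z], where z is the exponent vector of a monomial of
   degree d.  Hence the regularity is governed by the largest value D, over all
   such vectors, of the least degree realising the vector.

   The kernel of [boundary] mod N consists of the alternating vectors on the
   cycles: an edge outside the cycles is a bridge, two consecutive edges of a
   cycle form a cut, and in both cases the signed sum of the vertex equations
   over one side of the cut isolates the edges of the cut.  Averaging the
   degree over the translates by the alternating vectors gives
   D <= (N - 1)(s - sum k_i); the vector that is -1 off the cycles and
   alternately 0 and -1 along them attains the bound.  As degrees are determined
   mod N by the residues, the regularity is D - (N - 1). *)

Require Import Defs.
From HB Require Import structures.
From mathcomp Require Import all_boot all_order all_algebra.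
From mathcomp Require Import fingroup cyclic finfield.
From mathcomp Require Import mpoly zify.

Set Implicit Arguments.
Unset Strict Implicit.
Unset Printing Implicit Defensive.

Import GRing.Theory.
Local Open Scope ring_scope.

(** * Weights of residue vectors on the edges *)

(** The incidence map of the graph: it sends exponents on the edges to the exponents of the vertex
    variables after substitution of the edge monomials. *)
Definition boundary (V : finType) (s : nat) (e : 'I_s -> {set V})
    (R : nmodType) (z : {ffun 'I_s -> R}) : {ffun V -> R} :=
  [ffun v => \sum_(l | v \in e l) z l].

(** Here [n.+2] stands for q - 1. Lifting residues to 0, ..., q - 2 gives the least degree of a
    monomial with exponents congruent to [z]. *)
Definition weight (s n : nat) (z : {ffun 'I_s -> 'I_n.+2}) : nat :=
  (\sum_l z l)%N.

Lemma boundaryD (V : finType) (s : nat) (e : 'I_s -> {set V})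
    (R : nmodType) (y z : {ffun 'I_s -> R}) :
  boundary e (y + z) = boundary e y + boundary e z.
Proof.
apply/ffunP => v; rewrite !ffunE -big_split /=.
by apply: eq_bigr => l _; rewrite ffunE.
Qed.

Lemma boundaryB (V : finType) (s : nat) (e : 'I_s -> {set V})
    (R : zmodType) (y z : {ffun 'I_s -> R}) :
  boundary e (y - z) = boundary e y - boundary e z.
Proof.
apply/ffunP => v; rewrite !ffunE -sumrB.
by apply: eq_bigr => l _; rewrite !ffunE.
Qed.

Lemma sum_ord_bij (n : nat) (f : 'I_n.+2 -> 'I_n.+2) :
  injective f -> ((\sum_c f c) * 2 = n.+2 * n.+1)%N.
Proof.
move=> f_inj.
rewrite -(reindex_inj f_inj (P := xpredT) (F := fun c => nat_of_ord c)) /=.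
rewrite -(big_mkord xpredT id) bin2_sum -[2%N]/(2`!)%N bin_ffact.
by rewrite !ffactnS muln1.
Qed.

(** * Alternating vectors on even cycles and extremal weights *)

Section Cycles.

Variables (V T : finType) (s n : nat) (e : 'I_s -> {set V}).
Variables (cyc : T -> 'I_s) (g : T -> V) (next : T -> T) (sgn : T -> bool).
Hypothesis cyc_inj : injective cyc.
Hypothesis next_inj : injective next.
Hypothesis sgn_next : forall t, sgn (next t) = ~~ sgn t.
Hypothesis g_next : forall t, g t != g (next t).
Hypothesis e_cyc : forall t, e (cyc t) = [set g t; g (next t)].

Let sign_vector : {ffun 'I_s -> 'I_n.+2} :=
  [ffun l => \sum_(t | cyc t == l) (-1) ^+ sgn t].

Lemma boundary_sign_vector (c : 'I_n.+2) :
  boundary e [ffun l => sign_vector l * c] = 0.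
Proof.
apply/ffunP => v; rewrite !ffunE.
under eq_bigr do rewrite !ffunE.
rewrite -mulr_suml.
have -> : \sum_(l | v \in e l) \sum_(t | cyc t == l) (-1) ^+ sgn t =
    \sum_(t | v \in e (cyc t)) (-1) ^+ sgn t :> 'I_n.+2.
  rewrite [RHS](partition_big cyc (fun l => v \in e l)) //=.
  apply: eq_bigr => l vl; apply: eq_bigl => t.
  by case: eqP => [->|]; rewrite ?vl ?andbF.
have -> : \sum_(t | v \in e (cyc t)) (-1) ^+ sgn t =
    \sum_(t | v == g t) (-1) ^+ sgn t +
    \sum_(t | v == g (next t)) (-1) ^+ sgn t :> 'I_n.+2.
  rewrite (bigID (fun t => v == g t)) /=; congr (_ + _); apply: eq_bigl => t;
    rewrite e_cyc !inE; have := g_next t.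
    by case: (v =P g t) => [->|]; rewrite ?andbF.
  by case: (v =P g t) => [->|]; rewrite ?andbT //= => /negPf->.
(* Shifting one sum by [next] pairs consecutive edges at the vertex, whose signs are opposite. *)
rewrite (reindex_inj next_inj) /= -big_split big1 ?mul0r // => t _.
by rewrite sgn_next; case: (sgn t); rewrite /= expr0 expr1 ?subrr ?addNr.
Qed.

Lemma sign_vector_cyc t : sign_vector (cyc t) = (-1) ^+ sgn t.
Proof.
rewrite ffunE (bigD1 t) //= big1 ?addr0 // => t' /andP[/eqP/cyc_inj->].
by rewrite eqxx.
Qed.

Lemma sign_vector_notin l : l \notin codom cyc -> sign_vector l = 0.
Proof.
move=> lC; rewrite ffunE big1 // => t /eqP tl.
by rewrite -tl codom_f in lC.
Qed.

Lemma sum_codom (F : 'I_s -> nat) :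
  (\sum_l F l = \sum_(l | l \notin codom cyc) F l + \sum_t F (cyc t))%N.
Proof.
rewrite (bigID (mem (codom cyc))) /= addnC; congr addn.
rewrite -big_uniq /=; last by rewrite map_inj_uniq ?enum_uniq.
by rewrite codomE big_map big_enum.
Qed.

Lemma card_codom_compl : (#|[predC codom cyc]| + #|T| = s)%N.
Proof. by rewrite addnC -(card_codom cyc_inj) cardC card_ord. Qed.

(* Averaging over all translates by multiples of the sign vector: each
   coordinate on a cycle then runs through all residues. *)
Lemma small_weight (z : {ffun 'I_s -> 'I_n.+2}) :
  exists2 y : {ffun 'I_s -> 'I_n.+2}, boundary e y = boundary e z &
    (weight y * 2 <= n.+1 * (2 * s - #|T|))%N.
Proof.
pose y (c : 'I_n.+2) := z + [ffun l => sign_vector l * c].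
have yE c t : y c (cyc t) = z (cyc t) + (-1) ^+ sgn t * c.
  by rewrite /y ffunE ffunE sign_vector_cyc.
have [/existsP[c le_c]|] :=
    boolP [exists c, weight (y c) * 2 <= n.+1 * (2 * s - #|T|)]%N.
  by exists (y c) => //; rewrite boundaryD boundary_sign_vector addr0.
rewrite negb_exists => /forallP lt_y.
have : (\sum_(c : 'I_n.+2) n.+1 * (2 * s - #|T|) < \sum_c weight (y c) * 2)%N.
  rewrite (bigD1 0) // [ltnRHS](bigD1 0) //= -addSn leq_add //.
    by rewrite ltnNge lt_y.
  by apply: leq_sum => c _; rewrite ltnW // ltnNge lt_y.
rewrite sum_nat_const card_ord -big_distrl /= exchange_big /= sum_codom.
rewrite mulnDl [X in (_ + X)%N]big_distrl /=.
have -> : (\sum_t (\sum_c y c (cyc t)) * 2 = #|T| * (n.+2 * n.+1))%N.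
  rewrite -sum_nat_const; apply: eq_bigr => t _; apply: sum_ord_bij => c c'.
  by rewrite !yE => /addrI/(mulrI (unitrX _ (unitrN1 _))).
have : (\sum_(l | l \notin codom cyc) \sum_c y c l <=
    #|[predC codom cyc]| * (n.+2 * n.+1))%N.
  rewrite -sum_nat_const; apply: leq_sum => l _.
  rewrite -[X in (_ <= X * _)%N](card_ord n.+2) -sum_nat_const.
  by apply: leq_sum => c _; rewrite -ltnS.
(* Twice the average of a coordinate is at most [2 * n.+1] off the cycles and exactly [n.+1] on
   them. *)
have -> : (2 * s - #|T| = 2 * #|[predC codom cyc]| + #|T|)%N.
  by have := card_codom_compl; lia.
rewrite [X in (X < _)%N -> _]mulnA; set M := (n.+2 * n.+1)%N => leA.
by rewrite ltnNge mulnDr [(M * #|T|)%N]mulnC leq_add2r mulnCA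
  [(_ * 2)%N]mulnC leq_mul2l [(M * _)%N]mulnC leA.
Qed.

(* The residue vector equal to [-1] off the cycles and alternately to [0] and
   [-1] along each cycle. *)
Lemma large_weight :
  (forall z : {ffun 'I_s -> 'I_n.+2}, boundary e z = 0 ->
     (forall l, l \notin codom cyc -> z l = 0) /\
     (forall t, z (cyc t) + z (cyc (next t)) = 0)) ->
  exists z0 : {ffun 'I_s -> 'I_n.+2}, forall z, boundary e z = boundary e z0 ->
    (n.+1 * (2 * s - #|T|) <= weight z * 2)%N.
Proof.
move=> ker_e.
pose z0 : {ffun 'I_s -> 'I_n.+2} :=
  [ffun l => if [exists t, (cyc t == l) && sgn t] then 0 else -1].
have z0_cyc t : z0 (cyc t) = if sgn t then 0 else -1.
  rewrite ffunE; congr (if _ then _ else _); apply/existsP/idP => [[t']|st].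
    by move=> /andP[/eqP/cyc_inj->].
  by exists t; rewrite eqxx.
have z0_notin l : l \notin codom cyc -> z0 l = -1.
  move=> lC; rewrite ffunE; case: existsP => // -[t /andP[/eqP tl _]].
  by rewrite -tl codom_f in lC.
exists z0 => z ez.
have [|ker0 kerD] := ker_e (z - z0); first by rewrite boundaryB ez subrr.
have zB l : (z - z0) l = z l - z0 l by rewrite !ffunE.
have z_notin l : l \notin codom cyc -> z l = n.+1 :> nat.
  move=> lC; have := ker0 _ lC; rewrite zB => /subr0_eq->.
  by rewrite z0_notin //= subn1 modn_small.
(* On consecutive cycle edges [z] has the same sum -1 as [z0], and the least natural number with
   that residue is [n.+1]. Summing over [t] then counts each cycle edge twice. *)
have z_cyc t : (n.+1 <= z (cyc t) + z (cyc (next t)))%N.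
  have : z (cyc t) + z (cyc (next t)) = -1.
    have := kerD t; rewrite !zB addrACA -opprD => /subr0_eq->.
    by rewrite !z0_cyc sgn_next; case: (sgn t); rewrite ?addr0 ?add0r.
  move=> /(congr1 val) /= E; rewrite leqNgt; apply/negP => lt.
  by move: E; rewrite !modn_small ?subn1 //; lia.
rewrite /weight sum_codom (eq_bigr (fun=> n.+1)) // sum_nat_const.
have : (\sum_(t : T) n.+1 <= \sum_t (z (cyc t) + z (cyc (next t))))%N.
  by apply: leq_sum => t _; apply: z_cyc.
rewrite big_split sum_nat_const /= -[X in (_ <= _ + X)%N](reindex_inj next_inj
  (P := xpredT) (F := fun t => nat_of_ord (z (cyc t)))) addnn -muln2 => le_z.
have -> : (2 * s - #|T| = 2 * #|[predC codom cyc]| + #|T|)%N.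
  by have := card_codom_compl; lia.
by rewrite mulnDl mulnDr leq_add // mulnC // -mulnA mulnC.
Qed.

End Cycles.

(** * Cycles and cuts *)

Lemma ordS_neq (n : nat) (i : 'I_n) : (1 < n)%N -> ordS i != i.
Proof.
move=> n_gt1; apply/eqP => /(congr1 val) /=.
have := ltn_ord i; rewrite leq_eqVlt => /orP[/eqP n_eq|lt_i].
  by rewrite n_eq modnn; lia.
by rewrite modn_small //; lia.
Qed.

Lemma ordS2_neq (n : nat) (i : 'I_n) : (2 < n)%N -> ordS (ordS i) != i.
Proof.
move=> n_gt2; apply/eqP => /(congr1 val) /=; have lt_i := ltn_ord i.
have [lt_i2|] := ltnP i.+2 n; first by rewrite !modn_small //; lia.
rewrite leq_eqVlt => /orP[/eqP n_eq|le_n].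
  by rewrite (@modn_small i.+1) -?n_eq ?modnn; lia.
have -> : i.+1 = n by lia.
by rewrite modnn modn_small; lia.
Qed.

(** A simple path from [v] to [u] in [F] closes up through the edge. This shows later that the edges
    removed at a vertex form a cut. *)
Lemma cycle_through_edge (V : finType) (G : graph V) (F : {set {set V}})
    (v u : V) :
  simple G -> F \subset edges G -> [set v; u] \in edges G ->
  [set v; u] \notin F -> connect [rel x y | [set x; y] \in F] v u ->
  exists C : graph V, [/\ exists n, is_cycle C n, subgraph C G,
    [set v; u] \in edges C & edges C \subset [set v; u] |: F].
Proof.
move=> G_simple FG vuG vuF /connectP[p0 p0P uE].
have v_neq_u : v != u.
  by apply/eqP => vu; have [_] := G_simple _ vuG; rewrite vu setUid cards1.
move: v_neq_u vuF vuG; rewrite {}uE.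
case/shortenP: p0P => p pP p_uniq _ v_neq_u vuF vuG.
pose n := size (v :: p); pose f (i : 'I_n) := nth v (v :: p) i.
have f_inj : injective f.
  by move=> i j /eqP; rewrite nth_uniq // => /eqP/val_inj.
(* A shorter path would force [v = u] or put the edge itself in [F]. *)
have n_gt2 : (2 < n)%N.
  rewrite /n; move: pP v_neq_u vuF; case: (p) => [|x [|y q]] //=.
    by rewrite eqxx.
  by rewrite andbT => ->.
have i0 : 'I_n by apply: (@Ordinal _ 0); rewrite /n.
have f_step (i : 'I_n) :
    [set f i; f (ordS i)] = [set v; last v p] \/ [set f i; f (ordS i)] \in F.
  have := ltn_ord i; rewrite leq_eqVlt => /orP[/eqP i_last|lt_i]; [left|right].
    rewrite setUC /f /= i_last modnn /= -[X in nth _ _ X]/(i.+1.-1) i_last.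
    by rewrite /n /= -last_nth.
  rewrite /f /= modn_small //=.
  by have /pathP/(_ i) := pP; apply; rewrite -ltnS.
exists (Graph [set f i | i : 'I_n] [set [set f i; f (ordS i)] | i : 'I_n]).
have C_edges : [set [set f i; f (ordS i)] | i : 'I_n] \subset
    [set v; last v p] |: F.
  apply/subsetP => _ /imsetP[i _ ->]; rewrite !inE.
  by have [->|->] := f_step i; rewrite ?eqxx ?orbT.
have C_G : [set [set f i; f (ordS i)] | i : 'I_n] \subset edges G.
  by apply: subset_trans C_edges _; rewrite subUset sub1set vuG.
split => //.
- exists n; split=> //; exists f; split=> //; first by move=> i j _ _ /f_inj.
    by apply/setP => x; apply/imsetP/imsetP => -[i _ ->]; exists i.
  rewrite /cycle_graph /= -imset_comp; apply: eq_imset => i /=.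
  by rewrite imsetU !imset_set1.
- split=> //= [_ /imsetP[i _ ->]|].
    split; first by rewrite subUset !sub1set !imset_f.
    by rewrite cards2 (inj_eq f_inj) eq_sym ordS_neq // ltnW.
  apply/subsetP => _ /imsetP[i _ ->].
  have /G_simple[/subsetP sub _] : [set f i; f (ordS i)] \in edges G.
    by apply: (subsetP C_G); apply/imsetP; exists i.
  by apply: sub; rewrite !inE eqxx.
- have n1_lt : (n.-1 < n)%N by rewrite prednK.
  apply/imsetP; exists (Ordinal n1_lt) => //.
  by rewrite setUC /f /= -[(size p).+1]/n modnn /= (last_nth v).
Qed.

(* All edges in the cut around [S] meet [S] in the same vertex [v], hence have
   the same sign when the equations [boundary z = 0] over [S] are summed with
   the signs of a bipartition. *)
Lemma boundary_cut (V : finType) (s : nat) (e : 'I_s -> {set V})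
    (R : zmodType) (z : {ffun 'I_s -> R}) (A S : {set V}) (v : V)
    (P : pred 'I_s) :
  (forall l, exists x y, [/\ e l = [set x; y], x \in A & y \notin A]) ->
  boundary e z = 0 ->
  (forall l, P l -> e l :&: S = [set v]) ->
  (forall l, ~~ P l -> (e l \subset S) || [disjoint e l & S]) ->
  \sum_(l | P l) z l = 0.
Proof.
move=> e_bip ez P_cut nP_cut.
have swap (B : {set V}) :
    \sum_(w in S :&: B) boundary e z w = \sum_l z l *+ #|e l :&: (S :&: B)|.
  under eq_bigr do rewrite ffunE.
  rewrite (exchange_big_dep xpredT) //=; apply: eq_bigr => l _.
  rewrite sumr_const; congr (_ *+ _); apply: eq_card => w.
  by rewrite unfold_in !inE andbC.
(* An edge inside [S] contributes with both signs and one disjoint from [S] not at all; the cut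
   edges all carry the sign of the side of [v]. *)
have : \sum_l (z l *+ #|e l :&: (S :&: A)| -
    z l *+ #|e l :&: (S :&: ~: A)|) = 0.
  by rewrite sumrB -!swap ez !big1 ?subrr // => w _; rewrite ffunE.
rewrite (bigID P) /= [X in _ + X]big1 ?addr0 => [|l /nP_cut/orP[]].
- have cutE (B : {set V}) l : P l ->
      #|e l :&: (S :&: B)| = (v \in B) :> nat.
    move=> Pl; rewrite setIA P_cut //; have [vB|vB] := boolP (v \in B).
      by rewrite (setIidPl _) ?sub1set ?cards1.
    by apply/eqP; rewrite cards_eq0 setI_eq0 disjoints1.
  have [vA|vA] := boolP (v \in A).
    by rewrite (eq_bigr z) // => l Pl; rewrite !cutE // inE vA subr0.
  rewrite (eq_bigr (fun l => - z l)) => [|l Pl].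
    by rewrite sumrN => /eqP; rewrite oppr_eq0 => /eqP.
  by rewrite !cutE // inE (negPf vA) sub0r.
- have [x [y [-> xA yA]]] := e_bip l => eS.
  rewrite !setIA !(setIidPl eS).
  have -> : [set x; y] :&: A = [set x].
    by apply/setP => w; rewrite !inE; case: eqP => [->|_] //=;
      case: eqP => [->|_] //=; rewrite (negPf yA).
  have -> : [set x; y] :&: ~: A = [set y].
    apply/setP => w; rewrite !inE.
    case: (w =P y) => [->|_]; first by rewrite orbT.
    by rewrite orbF; case: eqP => [->|_] //=; rewrite xA.
  by rewrite !cards1 subrr.
- by rewrite -setI_eq0 => /eqP eS; rewrite !setIA eS !set0I cards0 subrr.
Qed.

(** * The kernel of the incidence map when the cycles are disjoint *)

Section CycleDisjointGraph.

Variables (V : finType) (s : nat) (e : 'I_s -> {set V}).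
Hypothesis e_inj : injective e.
Hypothesis e_simple : simple (graph_of e).
Hypothesis e_bip : bipartite (graph_of e).
Variables (m : nat) (H : 'I_m -> graph V) (k : 'I_m -> nat).
Hypothesis H_cycles : forall C : graph V,
  (subgraph C (graph_of e) /\ (exists n, is_cycle C n)) <->
  (exists i, C = H i).
Hypothesis H_length : forall i, is_cycle (H i) (2 * k i).
Hypothesis H_disjoint :
  forall i j, i != j -> [disjoint verts (H i) & verts (H j)].

Lemma H_subgraph i : subgraph (H i) (graph_of e).
Proof. by have [_ /(_ (ex_intro _ i erefl))[]] := H_cycles (H i). Qed.

Lemma edge_ends : exists A : {set V},
  forall l, exists x y, [/\ e l = [set x; y], x \in A & y \notin A].
Proof.
have [A A_bip] := e_bip; exists A => l.
have elG : e l \in edges (graph_of e) by apply: imset_f.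
have [_ /eqP/cards2P[x [y [_ exy]]]] := e_simple elG.
have /A_bip : adjacent (graph_of e) x y by rewrite /adjacent /= -exy.
by case: (boolP (x \in A)) (boolP (y \in A)) => xA [] yA // _;
  [exists x, y | exists y, x; rewrite setUC].
Qed.

(* [S] is the component of [v] after the edges of [P] have been removed; the
   other end of such an edge lies outside [S] unless a cycle closes up. *)
Lemma boundary_cut_at (R : zmodType) (z : {ffun 'I_s -> R}) (v : V)
    (P : pred 'I_s) :
  boundary e z = 0 -> (forall l, P l -> v \in e l) ->
  (forall l i, P l -> e l \in edges (H i) ->
     (forall l', P l' -> e l' \in edges (H i) -> l' = l) -> False) ->
  \sum_(l | P l) z l = 0.
Proof.
move=> ez vP no_cycle; have [A e_A] := edge_ends.
pose F := [set e l | l in predC P].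
pose S := [set w | connect [rel x y | [set x; y] \in F] v w].
apply: (boundary_cut (A := A) (S := S) (v := v)) => // l Pl; last first.
  have [x [y [exy _ _]]] := e_A l; have xyF : [set x; y] \in F.
    by rewrite -exy imset_f.
  have step w w' : [set w; w'] \in F -> w \in S -> w' \in S.
    by rewrite !inE => wF vw; apply: connect_trans vw (connect1 _).
  have [xS|xS] := boolP (x \in S).
    by rewrite exy subUset !sub1set xS (step x) ?orTb.
  apply/orP; right; rewrite exy disjoints_subset subUset !sub1set !inE.
  have yS : y \notin S by apply: contra xS; apply: step; rewrite setUC.
  by rewrite !inE in xS yS; rewrite xS yS.
have [u uv euv] : exists2 u, u != v & e l = [set v; u].
  have [x [y [exy xA yA]]] := e_A l.
  have xy : x != y by apply: contraNneq yA => <-.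
  have := vP l Pl; rewrite exy !inE => /orP[]/eqP->.
    by exists y; rewrite // eq_sym.
  by exists x; rewrite // setUC.
rewrite euv setIUl (setIidPl _) ?sub1set ?inE ?connect0 //.
(* If [u] were in [S], a path avoiding [P] would close up with [l] to a cycle whose only edge in [P]
   is [l]. *)
have [uS|uS] := boolP (u \in S); last first.
  by rewrite disjoint_setI0 ?setU0 // disjoints1.
exfalso.
have elF l' : (e l' \in F) = ~~ P l'.
  apply/imsetP/idP => [[l2 Pl2 /e_inj->] //|Pl']; exists l' => //.
have [||||C [C_cyc CG elC C_edges]] :=
  @cycle_through_edge _ (graph_of e) F v u e_simple.
- by apply/subsetP => _ /imsetP[l' _ ->]; apply: imset_f.
- by rewrite -euv imset_f.
- by rewrite -euv elF Pl.
- by rewrite inE in uS.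
have [i CH] := (H_cycles C).1 (conj CG C_cyc).
apply: (no_cycle l i Pl); first by rewrite -CH euv.
move=> l' Pl'; rewrite -CH => /(subsetP C_edges).
by rewrite -euv 2!inE elF Pl' orbF => /eqP/e_inj.
Qed.

Lemma cycle_parametrization (C : graph V) (n : nat) : is_cycle C n ->
  exists f : 'I_n -> V, [/\ injective f, verts C = [set f i | i : 'I_n] &
    edges C = [set [set f i; f (ordS i)] | i : 'I_n]].
Proof.
move=> [_ [f [f_inj <- <-]]]; exists f; split.
- by move=> i j /f_inj; apply; rewrite inE.
- by apply/setP => x; apply/imsetP/imsetP => -[i _ ->]; exists i.
- rewrite /cycle_graph /= -imset_comp; apply: eq_imset => i /=.
  by rewrite imsetU !imset_set1.
Qed.

Lemma weight_extrema (n : nat) :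
  (forall z : {ffun 'I_s -> 'I_n.+2},
     exists2 y : {ffun 'I_s -> 'I_n.+2}, boundary e y = boundary e z &
       (weight y <= n.+1 * (s - \sum_i k i))%N) /\
  (exists z0 : {ffun 'I_s -> 'I_n.+2}, forall z, boundary e z = boundary e z0 ->
     (n.+1 * (s - \sum_i k i) <= weight z)%N).
Proof.
have [f fP] := fin_all_exists (fun i => cycle_parametrization (H_length i)).
(* All positions on all cycles. The parity of the position serves as sign, consistently around a
   cycle because its length is even. *)
pose T := {i : 'I_m & 'I_(2 * k i)}.
pose g (t : T) := f (tag t) (tagged t).
pose next (t : T) : T := Tagged _ (ordS (tagged t)).
pose sgn (t : T) := odd (tagged t).
have g_verts (t : T) : g t \in verts (H (tag t)).
  by have [_ -> _] := fP (tag t); apply: imset_f.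
(* This is where the disjointness of the cycles enters. *)
have g_inj : injective g.
  move=> t t' gtt'; have tag_eq : tag t = tag t'.
    apply/eqP; have [//|/H_disjoint] := eqVneq (tag t) (tag t').
    by move=> /pred0P/(_ (g t)); rewrite /= g_verts {1}gtt' g_verts.
  move: t t' tag_eq gtt' => [i j] [i' j'] /= ii'.
  rewrite -{i'}ii' in j' *; have [f_inj _ _] := fP i.
  by rewrite /g /= => /f_inj->.
have next_inj : injective next.
  move=> [i j] [i' j'] E; have /= ii' := congr1 tag E.
  rewrite -{i'}ii' in j' E *.
  by have /eqP := E; rewrite /next /= -tag_eqE /tag_eq /= eqxx tagged_asE /= =>
    /eqP/ordS_inj->.
have sgn_next t : sgn (next t) = ~~ sgn t.
  by rewrite /sgn /next /= odd_mod // oddM.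
have next_neq t : next t != t.
  by apply/eqP => /(congr1 sgn); rewrite sgn_next; case: (sgn t).
have g_next t : g t != g (next t) by rewrite (inj_eq g_inj) eq_sym.
have next2_neq t : next (next t) != t.
  case: t => i j; rewrite /next /= -tag_eqE /tag_eq /= eqxx tagged_asE /=.
  by have [n_gt2 _] := H_length i; apply: ordS2_neq.
have edge_H (t : T) : [set g t; g (next t)] \in edges (H (tag t)).
  by have [_ _ ->] := fP (tag t); apply/imsetP; exists (tagged t).
have cyc_ex (t : T) : exists l, e l = [set g t; g (next t)].
  have [_ _ /subsetP/(_ _ (edge_H t))] := H_subgraph (tag t).
  by move=> /imsetP[l _ ->]; exists l.
have [cyc cycP] := fin_all_exists cyc_ex.
(* Equal edges with interchanged ends would give [next (next t) = t], impossible on a cycle of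
   length at least 3. *)
have cyc_inj : injective cyc.
  move=> t t' /(congr1 e); rewrite !cycP => E.
  have : g t \in [set g t; g (next t)] by rewrite !inE eqxx.
  rewrite E !inE !(inj_eq g_inj) => /orP[/eqP//|/eqP tt'].
  have : g (next t) \in [set g t; g (next t)] by rewrite !inE eqxx orbT.
  rewrite E !inE !(inj_eq g_inj) tt' => /orP[|/eqP/next_inj//].
  by rewrite (negPf (next2_neq _)).
have cyc_codom l i : e l \in edges (H i) -> exists2 t, l = cyc t & tag t = i.
  have [_ _ ->] := fP i => /imsetP[j _ el].
  exists (Tagged (fun i => 'I_(2 * k i)) j) => //.
  by apply: e_inj; rewrite cycP.
have card_T : (#|{: T}| = 2 * \sum_i k i)%N.
  rewrite card_tagged sumnE big_map big_enum /= big_distrr /=.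
  by apply: eq_bigr => i _; rewrite card_ord.
have ker_e (z : {ffun 'I_s -> 'I_n.+2}) : boundary e z = 0 ->
    (forall l, l \notin codom cyc -> z l = 0) /\
    (forall t, z (cyc t) + z (cyc (next t)) = 0).
  move=> ez; split=> [l lC|t].
    (* An edge lying on no [H i] is a cut by itself. *)
    have [A /(_ l)[v [u [elvu _ _]]]] := edge_ends.
    have := @boundary_cut_at _ z v (pred1 l) ez; rewrite big_pred1_eq; apply.
      by move=> _ /eqP->; rewrite elvu !inE eqxx.
    by move=> _ i /eqP-> /cyc_codom[t lt _]; rewrite lt codom_f in lC.
  (* A cycle containing one of two consecutive edges contains both, so neither is alone on it. *)
  have := @boundary_cut_at _ z (g (next t)) (pred2 (cyc t) (cyc (next t))) ez.
  rewrite (bigD1 (cyc t)) /= ?eqxx // (big_pred1 (cyc (next t))); last first.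
    move=> l /=; case: eqP => [->|_] /=; rewrite ?andbT //.
    by rewrite (inj_eq cyc_inj) eq_sym (negPf (next_neq t)).
  apply=> [_ /orP[]/eqP->|l i]; first by rewrite cycP !inE eqxx orbT.
    by rewrite cycP !inE eqxx.
  move=> Pl elH only; have ti : tag t = i.
    have [t' lt' <-] := cyc_codom _ _ elH; move: Pl.
    by rewrite lt' => /orP[]/eqP/cyc_inj->.
  have tl : cyc t = l.
    by apply: only; rewrite ?eqxx // cycP -ti edge_H.
  have ntl : cyc (next t) = l.
    by apply: only; rewrite ?eqxx ?orbT // cycP -ti edge_H.
  by have := next_neq t; rewrite -(inj_eq cyc_inj) tl ntl eqxx.
split=> [z|].
  have [y ey wy] := small_weight cyc_inj next_inj sgn_next g_next cycP z.
  by exists y => //; move: wy; rewrite card_T -mulnBr mulnCA mulnC leq_mul2l.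
have [z0 z0P] := large_weight cyc_inj next_inj sgn_next ker_e.
exists z0 => z /z0P.
by rewrite card_T -mulnBr mulnCA [(weight z * 2)%N]mulnC leq_mul2l.
Qed.

End CycleDisjointGraph.

(** * Characters of the torus *)

(* [u] ranges over the points of the torus; [b] is an exponent vector modulo
   q - 1. *)
Definition torus_char (K : finFieldType) (V : finType) (n : nat)
    (b : {ffun V -> 'I_n.+2}) : {ffun {ffun V -> {unit K}} -> K^o} :=
  [ffun u : {ffun V -> {unit K}} => \prod_v val (u v) ^+ b v].

Section Characters.

Variables (K : finFieldType) (n : nat).
Hypothesis card_K : #|K| = n.+3.

Lemma expr_unit_mod (u : {unit K}) (a : nat) :
  val u ^+ (a %% n.+2) = val u ^+ a.
Proof.
rewrite -!FinRing.val_unitX; congr (val _); apply: expg_mod.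
have := @expg_cardG _ [set: {unit K}]%G u.
by rewrite card_finField_unit card_K; apply; rewrite inE.
Qed.

Lemma expr_unitD (u : {unit K}) (a b : 'I_n.+2) :
  val u ^+ (a + b)%R = val u ^+ a * val u ^+ b.
Proof. by rewrite /= expr_unit_mod exprD. Qed.

(** In [K] the number q - 1 equals -1; orthogonality needs it to be nonzero. *)
Lemma natr_card_unit : n.+2%:R != 0 :> K.
Proof.
apply/eqP => n0; have /eqP := oner_eq0 K; apply.
have: (1 : K) *+ #|[set: K]| = 0 by rewrite -FinRing.zmodXgE expg_cardG ?inE.
by rewrite cardsT card_K -addn1 mulrnDr n0 add0r.
Qed.

(** Multiplication by a generator [h] of the units permutes the summands and scales the sum by
    [h ^+ c], which is not 1 unless [c = 0]. *)
Lemma sum_unit_power (c : 'I_n.+2) :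
  \sum_(u : {unit K}) val u ^+ c = (if c == 0 then n.+2%:R else 0).
Proof.
have [->|c_neq0] := eqVneq c 0.
  rewrite (eq_bigr (fun=> 1)) // sumr_const.
  by rewrite -cardsT card_finField_unit card_K.
have /cyclicP[h hP] := field_unit_group_cyclic [set: {unit K}].
have h_neq1 : val h ^+ c != 1.
  rewrite -FinRing.val_unitX -[1]/(val (1%g : {unit K})) (inj_eq val_inj).
  rewrite -order_dvdn /order -hP card_finField_unit card_K /=.
  apply: contra c_neq0 => dvd_c; apply/eqP/val_inj/eqP.
  rewrite /= -leqn0 leqNgt.
  by apply/negP => /dvdn_leq/(_ dvd_c); rewrite leqNgt ltn_ord.
apply: (mulfI (x := val h ^+ c - 1)); first by rewrite subr_eq0.
apply/eqP; rewrite mulr0 mulrBl mul1r subr_eq0 big_distrr /=.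
rewrite [X in _ == X](reindex_inj (mulgI h)) /=.
by apply/eqP/eq_bigr => u _; rewrite -exprMn.
Qed.

(** The sum over the torus factors into power sums over the units, one for each vertex; [- b'] gives
    the inverse character. *)
Lemma torus_char_orthogonal (V : finType) (b b' : {ffun V -> 'I_n.+2}) :
  \sum_u torus_char K b u * torus_char K (- b') u =
  (if b == b' then n.+2%:R ^+ #|V| else 0).
Proof.
under eq_bigr do rewrite !ffunE -big_split /=.
under eq_bigr do under eq_bigr do rewrite ffunE -expr_unitD.
rewrite -(bigA_distr_bigA (fun v (g : {unit K}) => val g ^+ (b v - b' v)%R)).
under eq_bigr do rewrite sum_unit_power subr_eq0.
have [->|neq] := eqVneq b b'.
  by rewrite (eq_bigr (fun=> n.+2%:R)) ?prodr_const // => v _; rewrite eqxx.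
have [v vP] : exists v, b v != b' v.
  apply/existsP; rewrite -negb_forall; apply: contra neq => /forallP eqb.
  by apply/eqP/ffunP => v; apply/eqP.
by rewrite (bigD1 v) //= (negPf vP) mul0r.
Qed.

(** Pairing a linear relation with the inverse of one character isolates its coefficient. *)
Lemma dim_torus_char (V : finType) (B : {set {ffun V -> 'I_n.+2}}) :
  \dim <<[seq torus_char K b | b <- enum B]>> = #|B|.
Proof.
pose X := map_tuple (@torus_char K V n) (enum_tuple B).
suff /eqP : free X by rewrite size_tuple.
have X_nth (i : 'I_#|B|) : X`_i = torus_char K (enum_val i).
  by rewrite /X /= (nth_map (enum_default i)) // -cardE.
apply/freeP => k; under eq_bigr do rewrite X_nth.
move=> k0 i.
have sumE u : (\sum_j k j *: torus_char K (enum_val j)) u =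
    \sum_j k j * torus_char K (enum_val j) u.
  rewrite (big_morph (fun f : {ffun {ffun V -> {unit K}} -> K^o} => f u)
    (id1 := 0) (op1 := +%R)) => [|f1 f2|]; rewrite ?ffunE //.
  by apply: eq_bigr => j _; rewrite ffunE.
have k0_at u : \sum_j k j * torus_char K (enum_val j) u = 0.
  rewrite -sumE; apply: etrans (congr1
    (fun f : {ffun {ffun V -> {unit K}} -> K^o} => f u) k0) _.
  by rewrite ffunE.
have : \sum_u (\sum_j k j * torus_char K (enum_val j) u) *
    torus_char K (- enum_val i) u = 0.
  by rewrite big1 // => u _; rewrite k0_at mul0r.
under eq_bigr do rewrite mulr_suml.
rewrite exchange_big /= (bigD1 i) //= [X in _ + X]big1 ?addr0 => [|j ji].
  under eq_bigr do rewrite -mulrA.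
  rewrite -mulr_sumr torus_char_orthogonal eqxx => /eqP.
  by rewrite mulf_eq0 expf_eq0 (negPf natr_card_unit) andbF orbF => /eqP.
under eq_bigr do rewrite -mulrA.
rewrite -mulr_sumr torus_char_orthogonal (inj_eq enum_val_inj) (negPf ji).
by rewrite mulr0.
Qed.

End Characters.

(** * The Hilbert function *)

Definition torus_eval (K : finFieldType) (V : finType) (s : nat)
    (e : 'I_s -> {set V}) (d : nat) (p : dhomog s K d) :
    {ffun {ffun V -> {unit K}} -> K^o} :=
  [ffun u : {ffun V -> {unit K}} =>
     (mpoly_of_dhomog p).@[edge_monomials e [ffun v => val (u v)] 0]].

Lemma torus_eval_linear (K : finFieldType) (V : finType) (s : nat)
  (e : 'I_s -> {set V}) (d : nat) : linear (@torus_eval K V s e d).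
Proof. by move=> a p q; apply/ffunP => u; rewrite !ffunE linearP. Qed.

HB.instance Definition _ (K : finFieldType) (V : finType) (s : nat)
    (e : 'I_s -> {set V}) (d : nat) :=
  GRing.isLinear.Build K (dhomog s K d) {ffun {ffun V -> {unit K}} -> K^o}
    *:%R (@torus_eval K V s e d) (torus_eval_linear e (d := d)).

(* Residue vectors realised in degree [d]: raising one exponent by multiples of
   n.+2 = q - 1 turns the weight of [z] into any larger congruent degree. *)
Definition degree_chars (V : finType) (s n : nat) (e : 'I_s -> {set V})
    (d : nat) : {set {ffun V -> 'I_n.+2}} :=
  [set boundary e z | z in
     [set z | (weight z <= d)%N && (weight z == d %[mod n.+2])]].

Lemma degree_charsP (V : finType) (r n : nat) (e : 'I_r.+1 -> {set V})
    (d : nat) (b : {ffun V -> 'I_n.+2}) :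
  reflect (exists2 a : 'X_{1..r.+1}, mdeg a = d &
            b = boundary e [ffun l => (a l)%:R])
    (b \in degree_chars n e d).
Proof.
apply: (iffP imsetP) => [[z]|[a <- ->]].
  rewrite inE => /andP[z_le z_mod] ->.
  exists [multinom z l + (l == ord0) * (d - weight z) | l < r.+1]%MM.
    rewrite mdegE (eq_bigr _ (fun l _ => mnmE _ l)) big_split /= -/(weight z).
    rewrite (bigD1 ord0) //= big1 => [|l /negPf->//].
    by rewrite mul1n addn0 subnKC.
  congr boundary; apply/ffunP => l; rewrite ffunE mnmE natrD natr_Zp.
  suff -> : ((l == ord0) * (d - weight z))%:R = 0 :> 'I_n.+2 by rewrite addr0.
  move: z_mod; rewrite eq_sym eqn_mod_dvd // => /dvdnP[c ->].
  by rewrite mulnA natrM (_ : n.+2%:R = 0) ?mulr0 //; apply: (@pchar_Zp n.+2).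
exists [ffun l => (a l)%:R] => //.
have wE : weight [ffun l => (a l)%:R : 'I_n.+2] = (\sum_l a l %% n.+2)%N.
  by apply: eq_bigr => l _; rewrite ffunE Zp_nat.
rewrite inE mdegE wE; apply/andP; split.
  by apply: leq_sum => l _; apply: leq_mod.
by rewrite modn_summ.
Qed.

Section HilbertFunction.

Variables (K : finFieldType) (n : nat).
Hypothesis card_K : #|K| = n.+3.

Lemma torus_eval_monomial (V : finType) (s : nat) (e : 'I_s -> {set V})
    (a : 'X_{1..s}) (u : {ffun V -> {unit K}}) :
  \prod_l (edge_monomials e [ffun v => val (u v)] 0 l) ^+ a l =
  torus_char K (boundary e [ffun l => (a l)%:R : 'I_n.+2]) u.
Proof.
rewrite ffunE; under eq_bigr do rewrite mxE -prodrXl.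
rewrite (exchange_big_dep xpredT) //=; apply: eq_bigr => v _.
rewrite prodrXr !ffunE; under [in RHS]eq_bigr do rewrite ffunE.
by rewrite -natr_sum Zp_nat /= (expr_unit_mod card_K).
Qed.

Lemma mem_vanishing_component (V : finType) (r : nat)
    (e : 'I_r.+1 -> {set V}) (d : nat) (p : dhomog r.+1 K d) :
  (p \in vanishing_ideal_component (toric_set K e) d) = (torus_eval e p == 0).
Proof.
apply/idP/eqP => [/vanishing_ideal_componentP[t tG pt]|p0].
  apply/ffunP => u; rewrite !ffunE pt raddf_sum /= big_seq big1 // => ag agt.
  rewrite mevalM (proj2 (tG _ agt)
    (proj_point (edge_monomials e [ffun v => val (u v)]))) ?mulr0 //.
    apply/imsetP; exists [ffun v => val (u v)] => //; rewrite inE.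
    by apply/forallP => v; rewrite ffunE -unitfE (valP (u v)).
  by apply/imsetP; exists 1; rewrite ?scale1r // inE oner_eq0.
apply/vanishing_ideal_componentP; exists [:: (1, mpoly_of_dhomog p)]; last first.
  by rewrite big_seq1 mul1r.
move=> _ /[!inE] /eqP-> /=; split.
  by apply/homogP; exists d; apply: dhomog_is_dhomog.
move=> _ _ /imsetP[x x_neq0 ->] /imsetP[c _ ->].
rewrite inE in x_neq0; move/forallP in x_neq0.
have xU v : x v \is a GRing.unit by rewrite unitfE.
pose u := [ffun v => FinRing.Unit (xU v)].
have /ffunP/(_ u) := p0; rewrite !ffunE.
have -> : [ffun v => val (u v)] = x by apply/ffunP => v; rewrite !ffunE.
rewrite !mevalE => px.
(* Homogeneity carries the vanishing over to all representatives of the point. *)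
transitivity (c ^+ d * (mpoly_of_dhomog p).@[edge_monomials e x 0]).
  rewrite mevalE mulr_sumr big_seq [RHS]big_seq; apply: eq_bigr => a ap.
  rewrite mulrCA; congr (_ * _); under eq_bigr do rewrite mxE exprMn.
  rewrite big_split /= prodrXr -mdegE; congr (_ ^+ _ * _).
  by have /dhomogP := dhomog_is_dhomog p; apply.
by rewrite mevalE px mulr0.
Qed.

(** Rank-nullity for evaluation on the torus: the kernel is the degree [d] part of the ideal, and
    the image is spanned by the characters of monomials of degree [d]. *)
Lemma hilbert_function_card (V : finType) (r : nat)
    (e : 'I_r.+1 -> {set V}) (d : nat) :
  hilbert_function (toric_set K e) d = #|degree_chars n e d|.
Proof.
pose f := linfun (torus_eval e (d := d) : dhomog r.+1 K d -> _).
have kerE : vanishing_ideal_component (toric_set K e) d = lker f.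
  by apply/vspaceP => p; rewrite mem_vanishing_component memv_ker lfunE.
rewrite /hilbert_function kerE -(limg_ker_dim f) capfv addKn.
rewrite -(dim_torus_char card_K); congr (\dim _).
apply/eqP; rewrite eqEsubv; apply/andP; split.
  apply/subvP => _ /memv_imgP[p _ ->]; rewrite lfunE /=.
  have -> : torus_eval e p = \sum_(a <- msupp (mpoly_of_dhomog p))
      (mpoly_of_dhomog p)@_a *:
        torus_char K (boundary e [ffun l => (a l)%:R : 'I_n.+2]).
    apply/ffunP => u; rewrite ffunE mevalE.
    rewrite (big_morph (fun f : {ffun {ffun V -> {unit K}} -> K^o} => f u)
      (id1 := 0) (op1 := +%R)) => [|f1 f2|]; rewrite ?ffunE //.
    by apply: eq_bigr => a _; rewrite torus_eval_monomial [RHS]ffunE.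
  rewrite big_seq memv_suml // => a ap; rewrite memvZ // memv_span // map_f //.
  rewrite mem_enum; apply/degree_charsP; exists a => //.
  by have /dhomogP := dhomog_is_dhomog p; apply.
apply/span_subvP => _ /mapP[b + ->]; rewrite mem_enum.
move=> /degree_charsP[a ad ->].
have Xd : ('X_[a] : {mpoly K[r.+1]}) \is d.-homog for mdeg.
  by rewrite dhomogX; apply/eqP.
apply/memv_imgP; exists (DHomog Xd); rewrite ?memvf // lfunE /=.
by apply/ffunP => u; rewrite [RHS]ffunE /= mevalX torus_eval_monomial.
Qed.

End HilbertFunction.

(** * The regularity *)

(** The residue vectors from all degrees congruent to [c]; [degree_chars] fills this set once the
    degree is large. *)
Definition total_chars (V : finType) (s n : nat) (e : 'I_s -> {set V})
    (c : 'I_n.+2) : {set {ffun V -> 'I_n.+2}} :=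
  [set boundary e z | z : {ffun 'I_s -> 'I_n.+2} & \sum_l z l == c].

Lemma eq_natr_Zp (n a b : nat) :
  (a%:R == b%:R :> 'I_n.+2) = (a == b %[mod n.+2]).
Proof. by rewrite !Zp_nat -val_eqE. Qed.

Lemma sum_weight (s n : nat) (z : {ffun 'I_s -> 'I_n.+2}) :
  \sum_l z l = (weight z)%:R.
Proof. by rewrite natr_sum; apply: eq_bigr => l _; rewrite natr_Zp. Qed.

Lemma degree_chars_sub (V : finType) (s n : nat) (e : 'I_s -> {set V})
    (d : nat) : degree_chars n e d \subset total_chars e d%:R.
Proof.
apply/subsetP => _ /imsetP[z + ->]; rewrite inE => /andP[_ z_mod].
by apply/imsetP; exists z; rewrite // inE sum_weight eq_natr_Zp.
Qed.

(** Translation by the boundary of a vector of total [c] is a bijection, so the Hilbert function is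
    eventually constant. *)
Lemma card_total_chars (V : finType) (r n : nat) (e : 'I_r.+1 -> {set V})
    (c : 'I_n.+2) : #|total_chars e c| = #|total_chars e (0 : 'I_n.+2)|.
Proof.
pose y : {ffun 'I_r.+1 -> 'I_n.+2} := [ffun l => if l == ord0 then c else 0].
have sum_y : \sum_l y l = c.
  rewrite (bigD1 ord0) //= big1 => [|l /negPf l0]; rewrite ffunE ?l0 //.
  by rewrite eqxx addr0.
rewrite -(card_imset (mem (total_chars e 0)) (addIr (boundary e y))).
apply: eq_card => b; apply/imsetP/imsetP => [[z + ->]|[_ /imsetP[z + ->] ->]].
  rewrite inE => /eqP sum_z; exists (boundary e (z - y)).
    apply/imsetP; exists (z - y); rewrite // inE.
    under eq_bigr do rewrite ffunE [X in _ + X]ffunE.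
    by rewrite sumrB sum_z sum_y subrr.
  by rewrite -boundaryD subrK.
rewrite inE => /eqP sum_z; exists (z + y); last by rewrite boundaryD.
rewrite inE; under eq_bigr do rewrite ffunE.
by rewrite big_split /= sum_z sum_y add0r.
Qed.

(** Each edge has exactly one end in [A], so the boundary determines the degree mod q - 1. *)
Lemma sum_boundary (V : finType) (s : nat) (e : 'I_s -> {set V})
    (R : nmodType) (A : {set V}) (z : {ffun 'I_s -> R}) :
  (forall l, exists x y, [/\ e l = [set x; y], x \in A & y \notin A]) ->
  \sum_l z l = \sum_(v in A) boundary e z v.
Proof.
move=> e_A; under [RHS]eq_bigr do rewrite ffunE.
rewrite (exchange_big_dep xpredT) //=; apply: eq_bigr => l _.
have [x [y [-> xA yA]]] := e_A l; rewrite (big_pred1 x) // => v.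
rewrite !inE /=; have [->|_] := eqVneq v x; first by rewrite xA.
by have [->|_] := eqVneq v y; rewrite ?andbF // (negPf yA).
Qed.

(* The residue of the degree [d] is the total of the residue vector, so a
   character of total [d] whose lightest representative weighs less than
   [d + n.+2] already has degree [d]. *)
Lemma regularity_of_weight_extremum (K : finFieldType) (V : finType)
    (r n : nat) (e : 'I_r.+1 -> {set V}) (A : {set V}) (w : nat) :
  #|K| = n.+3 ->
  (forall l, exists x y, [/\ e l = [set x; y], x \in A & y \notin A]) ->
  (forall z : {ffun 'I_r.+1 -> 'I_n.+2},
     exists2 y : {ffun 'I_r.+1 -> 'I_n.+2}, boundary e y = boundary e z &
       (weight y <= n.+1 * w)%N) ->
  (exists z0 : {ffun 'I_r.+1 -> 'I_n.+2},
     forall z, boundary e z = boundary e z0 -> (n.+1 * w <= weight z)%N) ->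
  is_regularity (toric_set K e) (n.+1 * w.-1).
Proof.
move=> card_K e_A upper [z0 lower].
have total (z : {ffun 'I_r.+1 -> 'I_n.+2}) := sum_boundary z e_A.
(* Otherwise every boundary would be that of the zero vector, yet a single entry 1 gives total 1. *)
have w_gt0 : (0 < w)%N.
  rewrite lt0n; apply/eqP => w0.
  pose z : {ffun 'I_r.+1 -> 'I_n.+2} := [ffun l => if l == ord0 then 1 else 0].
  have [y ey] := upper z; rewrite w0 muln0 leqn0 => /eqP y0.
  have := total y; rewrite ey -total sum_weight y0 (bigD1 ord0) //= big1.
    by rewrite ffunE eqxx => /eqP.
  by move=> l /negPf l0; rewrite ffunE l0.
have charsE d : (n.+1 * w.-1 <= d)%N -> degree_chars n e d = total_chars e d%:R.
  move=> le_d; apply/eqP; rewrite eqEsubset degree_chars_sub /=.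
  apply/subsetP => _ /imsetP[z + ->]; rewrite inE total => /eqP sum_z.
  have [y ey y_le] := upper z; apply/imsetP; exists y => //.
  have y_mod : weight y == d %[mod n.+2].
    by rewrite -eq_natr_Zp -sum_weight total ey sum_z.
  (* A positive excess over [d] is at least [n.+2], while [upper] leaves room for [n.+1] only. *)
  rewrite inE y_mod andbT leqNgt; apply/negP => lt_d.
  move: y_mod; rewrite eqn_mod_dvd ?(ltnW lt_d) // => /dvdn_leq.
  rewrite subn_gt0 => /(_ lt_d); rewrite leqNgt => /negP[].
  rewrite ltnS leq_subLR; apply: leq_trans y_le _.
  by rewrite -(prednK w_gt0) mulnS addnC leq_add2r.
have H_stable d : (n.+1 * w.-1 <= d)%N ->
    hilbert_function (toric_set K e) d = #|total_chars e (0 : 'I_n.+2)|.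
  move=> le_d; rewrite (hilbert_function_card card_K) charsE //.
  exact: card_total_chars.
exists (#|total_chars e (0 : 'I_n.+2)|)%:R%:P.
  by exists (n.+1 * w.-1)%N => d le_d; rewrite hornerC H_stable.
split=> [d le_d|l' stable]; first by rewrite hornerC H_stable.
rewrite leqNgt; apply/negP => lt_l'.
(* The degree just below the claimed value, which [lt_l'] makes positive. *)
pose d := (n.+1 * w.-1).-1.
have d_eq : (n.+1 * w.-1 = d.+1)%N.
  by rewrite prednK //; apply: leq_ltn_trans lt_l'.
have := stable d; rewrite -ltnS -d_eq lt_l' hornerC => /(_ isT) /eqP.
rewrite Num.Theory.eqr_nat (hilbert_function_card card_K).
rewrite -(card_total_chars e d%:R) => /eqP card_eq.
have chars_eq : degree_chars n e d = total_chars e d%:R.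
  by apply/eqP; rewrite eqEcard degree_chars_sub card_eq leqnn.
have [y ey y_le] := upper z0.
(* As [n.+1 * w] equals [d + n.+2], the vector of [z0] has the total of degree [d], but no
   representative of weight at most [d]. *)
have wy : weight y = (d + n.+2)%N.
  apply/eqP; rewrite addnS -addSn -d_eq addnC -mulnS prednK // eqn_leq y_le.
  exact: lower.
have : boundary e y \in total_chars e d%:R.
  by apply/imsetP; exists y; rewrite // inE sum_weight eq_natr_Zp wy modnDr.
rewrite -chars_eq => /imsetP[z]; rewrite inE => /andP[z_le _] yz.
have := lower z; rewrite -yz => /(_ ey); rewrite leqNgt => /negP[].
by rewrite -(prednK w_gt0) mulnS d_eq addnS ltnS (leq_trans z_le) ?leq_addl.
Qed.

Local Close Scope ring_scope.

Theorem corollary6p5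
  (K : finFieldType) (hK : 2 < #|K|)
  (V : finType) (r : nat) (e : 'I_r.+1 -> {set V})
  (e_inj : injective e) (e_simple : simple (graph_of e))
  (two_edges : 2 <= r.+1)
  (G_no_isolated : no_isolated (graph_of e))
  (G_connected : connected (graph_of e))
  (G_bipartite : bipartite (graph_of e))
  (m : nat) (H : 'I_m -> graph V) (k : 'I_m -> nat)
  (H_inj : injective H)
  (H_cycles : forall C : graph V,
     (subgraph C (graph_of e) /\ (exists n, is_cycle C n)) <->
     (exists i, C = H i))
  (H_length : forall i, is_cycle (H i) (2 * k i))
  (H_disjoint : forall i j, i != j -> [disjoint verts (H i) & verts (H j)]) :
  is_regularity (toric_set K e)
    ((#|K| - 2) * (r.+1 - \sum_(i < m) k i - 1)).
Proof.
have [n card_K] : exists n, #|K| = n.+3.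
  by case: #|K| hK => [|[|[|n]]] // _; exists n.
have [A e_A] := edge_ends e_simple G_bipartite.
have [upper lower] :=
  weight_extrema e_inj e_simple G_bipartite H_cycles H_length H_disjoint n.
rewrite subn1 card_K subSS subSS subn0.
exact: regularity_of_weight_extremum card_K e_A upper lower.
Qed.
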